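(* Let $(X,X_+)$ be a pre-ordered vector space, let $W=\overline{(X_+)}_{ru}$ be the $\tau_{ru}$-closure of $X_+$, and let $A=W\cap -W$. Let $X/A$ be the quotient space and, for $B\subseteq X$, let $[B]=\{[x]\in X/A : x\in B\}$. Then: (i) $[W]$ is an Archimedean cone in $X/A$; (ii) $[X_+]$ is an almost Archimedean cone in $X/A$; (iii) $[W]$ is generating in $X/A$ if and only if $X_+$ is generating in $X$.
   Context: All vector spaces are real. A non-empty subset $W$ of a vector space $X$ is a wedge if $W+W\subseteq W$ and $tW\subseteq W$ for all $t\ge 0$; a wedge $C$ is a cone if $C\cap -C=\{0\}$. A pre-ordered vector space (POVS) is a vector space $X$ together with a wedge $X_+$ (its positive wedge); write $x\le y$ iff $y-x\in X_+$, and for any wedge $W$ write $x\le_W y$ iff $y-x\in W$. A subset $A$ of a vector space $X$ is generating if $A-A=X$. A wedge $W$ in a vector space is almost Archimedean if $y=0$ whenever there is $u\in W$ with $\pm ny\le_W u$ for all $n\in\mathbb N$; it is Archimedean if $y\le_W 0$ whenever there is $u\in W$ with $ny\le_W u$ for all $n\in\mathbb N$. In a POVS $X$, a sequence $(x_n)$ ru-converges to $x$ (written $x_n\xrightarrow{ru}x$) if for some $w\in X$ and some sequence of indices $(m_k)_k$ one has $\pm k(x_n-x)\le w$ for all $n\ge m_k$, for every $k\in\mathbb N$. The ru-topology $\tau_{ru}$ on $X$ is the topology whose closed sets are exactly the $S\subseteq X$ such that $S\ni x_n\xrightarrow{ru}x$ implies $x\in S$; $\overline{S}_{ru}$ is the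 $\tau_{ru}$-closure of $S$ (always taken with respect to $X_+$). *)

(* Defs.v *)
From HB Require Import structures.
From mathcomp Require Import all_boot all_order all_algebra.
From mathcomp Require Import all_classical all_reals.
From mathcomp Require Import topology.

Set Implicit Arguments.
Unset Strict Implicit.
Unset Printing Implicit Defensive.

Import Order.TTheory GRing.Theory Num.Theory.
Local Open Scope classical_set_scope.
Local Open Scope ring_scope.
Local Open Scope quotient_scope.

Section Wedges.
Variables (R : realType) (X : lmodType R).
Implicit Types (W B : set X) (x y u : X).

Definition is_wedge W : Prop :=
  [/\ W !=set0,
      forall x y, W x -> W y -> W (x + y)
    & forall (t : R) x, 0 <= t -> W x -> W (t *: x)].

Definition opp_set B : set X := [set - x | x in B].

Definition is_cone W : Prop := is_wedge W /\ W `&` opp_set W = [set 0].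

Definition wle W x y : Prop := W (y - x).

Definition generating B : Prop := [set a - b | a in B & b in B] = [set: X].

Definition almost_archimedean W : Prop :=
  forall y, (exists2 u, W u &
    forall n : nat, wle W (y *+ n) u /\ wle W (- (y *+ n)) u) -> y = 0.

Definition archimedean W : Prop :=
  forall y, (exists2 u, W u & forall n : nat, wle W (y *+ n) u) -> wle W y 0.

End Wedges.

(* A pair (X, P) with P : wedge X is a pre-ordered vector space with positive
   wedge P. *)
Record wedge (R : realType) (X : lmodType R) := Wedge {
  wedge_set :> set X;
  wedgeP : is_wedge wedge_set }.

(* X with the topology tau_ru of the positive wedge P; the unused argument P
   keeps the topologies of different wedges on X apart. *)
Definition ru_space (R : realType) (X : lmodType R) (P : set X) : Type := X.

Section RuTopology.
Variables (R : realType) (X : lmodType R) (P : set X).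

Definition ru_cvg (x_ : nat -> X) (x : X) : Prop :=
  exists (w : X) (m : nat -> nat), forall k n : nat, (m k <= n)%N ->
    wle P ((x_ n - x) *+ k) w /\ wle P (- ((x_ n - x) *+ k)) w.

Definition ru_closed (S : set X) : Prop :=
  forall (x_ : nat -> X) (x : X), (forall n, S (x_ n)) -> ru_cvg x_ x -> S x.

Lemma ru_cvg_subseq (x_ : nat -> X) x (f : nat -> nat) :
  (forall n, (n <= f n)%N) -> ru_cvg x_ x -> ru_cvg (x_ \o f) x.
Proof.
move=> fn [w [m H]]; exists w, m => k n kn; apply: H.
exact: leq_trans kn (fn n).
Qed.

Lemma ru_closedU S T : ru_closed S -> ru_closed T -> ru_closed (S `|` T).
Proof.
move=> cS cT x_ x xST xx.
have [[f Hf]|] := pselect (exists f : nat -> nat,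
    forall n, (n <= f n)%N /\ S (x_ (f n))).
  left; apply: (cS (x_ \o f)) => [n|]; first by have [] := Hf n.
  by apply: ru_cvg_subseq => // n; have [] := Hf n.
move=> nf; right.
have [N HN] : exists N, forall n, (N <= n)%N -> ~ S (x_ n).
  apply: contrapT => nN; apply: nf.
  have /choice[f Hf] : forall N, exists n, (N <= n)%N /\ S (x_ n).
    move=> N; apply: contrapT => nn; apply: nN; exists N => n Nn Sn.
    by apply: nn; exists n.
  by exists f.
apply: (cT (x_ \o addn N)) => [n|].
  by have /= := xST (N + n)%N; case=> // /HN; case; rewrite leq_addr.
by apply: ru_cvg_subseq => // n; rewrite leq_addl.
Qed.

Local Notation ru_space := (ru_space P).

HB.instance Definition _ := Choice.on ru_space.

Definition ru_open (U : set ru_space) : Prop := ru_closed (~` U).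

Lemma ru_openT : ru_open setT.
Proof. by move=> x_ x /(_ 0%N) []. Qed.

Lemma ru_openI : setI_closed ru_open.
Proof. by move=> U V oU oV; rewrite /ru_open setCI; apply: ru_closedU. Qed.

Lemma ru_open_bigU (I : Type) (f : I -> set ru_space) :
  (forall i, ru_open (f i)) -> ru_open (\bigcup_i f i).
Proof.
move=> of_ x_ x xf xx [i _ fix_]; apply: (of_ i x_ x _ xx fix_) => n fin.
by apply: (xf n); exists i.
Qed.

HB.instance Definition _ :=
  isOpenTopological.Build ru_space ru_openT ru_openI ru_open_bigU.

Lemma closed_ruE (S : set ru_space) : closed S <-> ru_closed S.
Proof. by rewrite -openC /open/= /ru_open setCK. Qed.

Definition ru_closure (S : set X) : set X := @closure ru_space S.

Lemma ru_closure_closed S : ru_closed (ru_closure S).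
Proof. exact/closed_ruE/closed_closure. Qed.

Lemma sub_ru_closure S : S `<=` ru_closure S.
Proof. exact: (@subset_closure ru_space S). Qed.

Lemma ru_closure_min S T : ru_closed T -> S `<=` T -> ru_closure S `<=` T.
Proof. by move=> /closed_ruE cT ST; rewrite /ru_closure closureE; apply: smallest_sub. Qed.

End RuTopology.

Section ClosureWedge.
Variables (R : realType) (X : lmodType R) (P : set X) (wP : is_wedge P).
Local Notation W := (ru_closure P P).

Let wD x y : P x -> P y -> P (x + y).
Proof. by case: wP => _ + _; apply. Qed.

Let wZ (t : R) x : 0 <= t -> P x -> P (t *: x).
Proof. by case: wP => _ _; apply. Qed.

Lemma ru_cvgD (x_ : nat -> X) x y :
  ru_cvg P x_ x -> ru_cvg P (fun n => x_ n + y) (x + y).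
Proof.
move=> [w [m H]]; exists w, m => k n kn.
by rewrite opprD addrACA subrr addr0; apply: H.
Qed.

Lemma ru_cvgZ (t : R) (x_ : nat -> X) x :
  0 <= t -> ru_cvg P x_ x -> ru_cvg P (fun n => t *: x_ n) (t *: x).
Proof.
move=> t0 [w [m H]]; exists (t *: w), m => k n kn.
have [H1 H2] := H k n kn.
rewrite /wle -scalerBr scalerMnr.
by split; last rewrite -[X in _ - X]scalerN; rewrite -scalerBr; apply: wZ.
Qed.

Lemma ru_closure_is_wedge : is_wedge W.
Proof.
have sub : P `<=` W by apply: sub_ru_closure.
have clD x : ru_closed P [set y | W (y + x)].
  move=> y_ z yW /(@ru_cvgD _ _ x) yz.
  exact: (ru_closure_closed (x_ := fun n => y_ n + x)).
have clZ (t : R) : 0 <= t -> ru_closed P [set y | W (t *: y)].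
  move=> t0 y_ z yW /(ru_cvgZ t0) yz.
  exact: (ru_closure_closed (x_ := fun n => t *: y_ n)).
have WD1 x y : P x -> W y -> W (y + x).
  move=> Px; apply: (ru_closure_min (clD x)) => z Pz /=.
  by apply/sub/wD.
split.
- by have [[x Px] _ _] := wP; exists x; apply: sub.
- move=> x y + Wy; apply: (ru_closure_min (clD y)) => z Pz /=.
  by rewrite addrC; apply: WD1.
- move=> t x t0; apply: (ru_closure_min (clZ t t0)) => z Pz /=.
  by apply/sub/wZ.
Qed.

End ClosureWedge.

Definition ru_closure_wedge (R : realType) (X : lmodType R) (P : wedge X) :
  wedge X := Wedge (ru_closure_is_wedge (wedgeP P)).

Section Lineality.
Variables (R : realType) (X : lmodType R) (W : wedge X).

Definition lineality : {pred X} := fun x => x \in (W : set X) `&` opp_set W.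

Lemma lineality_submod_closed : submod_closed lineality.
Proof.
have [[x0 Wx0] WD WZ] := wedgeP W.
have W0 : (W : set X) 0 by rewrite -(scale0r x0); apply: WZ.
have E x : (x \in lineality) = `[< (W : set X) x /\ (W : set X) (- x) >].
  transitivity (x \in (W : set X) `&` opp_set W) => //.
  apply: asbool_equiv_eq; split.
    by move=> [+ [y Wy yx]]; rewrite -yx opprK; split.
  by move=> [Wx WNx]; split=> //; exists (- x); rewrite ?opprK.
split; first by rewrite E; apply/asboolP; rewrite oppr0.
move=> a x y; rewrite !E => /asboolP[Wx WNx] /asboolP[Wy WNy]; apply/asboolP.
rewrite opprD; have [a0|/ltW a0] := leP 0 a.
  by rewrite -scalerN; split; apply: WD => //; apply: WZ.
have Na0 : 0 <= - a by rewrite oppr_ge0.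
split; apply: WD => //; last by rewrite -scaleNr; apply: WZ.
by rewrite -[a]opprK scaleNr -scalerN; apply: WZ.
Qed.

HB.instance Definition _ :=
  GRing.isSubmodClosed.Build R X lineality lineality_submod_closed.

End Lineality.

(* X/A as a vector space: Quotient.quot provides only its additive group
   structure, and takes a zmodClosed rather than a submodClosed. *)
Section QuotientSpace.
Variables (R : realType) (X : lmodType R) (A : submodClosed X).

Definition subspace_pred : {pred X} := fun x => x \in A.

Lemma subspace_zmod_closed : zmod_closed subspace_pred.
Proof. exact: GRing.submod_closedB (submodClosedP A). Qed.

HB.instance Definition _ :=
  GRing.isZmodClosed.Build X subspace_pred subspace_zmod_closed.

Local Notation zquot := (Quotient.quot (subspace_pred : zmodClosed X)).

Definition quot_space : Type := zquot.

HB.instance Definition _ := GRing.Zmodule.on quot_space.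

Definition class_of (x : X) : quot_space := \pi_zquot x.

Definition quot_scale (a : R) (q : quot_space) : quot_space :=
  class_of (a *: repr (q : zquot)).

Lemma class_of_eq x y : class_of x = class_of y <-> x - y \in A.
Proof.
rewrite -[x - y \in A]/(x - y \in subspace_pred).
by rewrite Quotient.idealrBE; split=> [/eqP|/eqP]. Qed.

Lemma class_ofK (q : quot_space) : class_of (repr (q : zquot)) = q.
Proof. exact: reprK. Qed.

Lemma class_ofD x y : class_of (x + y) = class_of x + class_of y.
Proof. exact: (raddfD (\pi_zquot)). Qed.

Lemma class_ofZ a x : class_of (a *: x) = quot_scale a (class_of x).
Proof.
apply/class_of_eq; rewrite -scalerBr rpredZ //.
by apply/class_of_eq; rewrite class_ofK.
Qed.

Lemma quot_scaleA a b q :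
  quot_scale a (quot_scale b q) = quot_scale (a * b) q.
Proof. by rewrite -(class_ofK q) -!class_ofZ scalerA. Qed.

Lemma quot_scale1 : left_id 1 quot_scale.
Proof. by move=> q; rewrite -(class_ofK q) -class_ofZ scale1r. Qed.

Lemma quot_scaleDr : right_distributive quot_scale +%R.
Proof.
move=> a p q; rewrite -(class_ofK p) -(class_ofK q).
by rewrite -class_ofD -!class_ofZ scalerDr class_ofD.
Qed.

Lemma quot_scaleDl q : {morph quot_scale^~ q : a b / a + b}.
Proof.
by move=> a b; rewrite -(class_ofK q) -!class_ofZ scalerDl class_ofD.
Qed.

HB.instance Definition _ := GRing.Zmodule_isLmodule.Build R quot_space
  quot_scaleA quot_scale1 quot_scaleDr quot_scaleDl.

Lemma class_of_is_linear : linear class_of.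
Proof. by move=> a x y; rewrite class_ofD class_ofZ. Qed.

HB.instance Definition _ := GRing.isLinear.Build R X quot_space *:%R class_of
  class_of_is_linear.

Definition class_set (B : set X) : set quot_space := [set class_of x | x in B].

End QuotientSpace.
Arguments class_of {R X} A x.
Arguments class_set {R X} A B.

(* Main.v *)
Require Import Defs.
From HB Require Import structures.
From mathcomp Require Import all_boot all_order all_algebra.
From mathcomp Require Import all_classical all_reals.

(** Write [P] for the positive wedge and [W] for its ru-closure.  Everything
    rests on two remarks about the span [P - P].

    First, [P - P] is ru-closed ([ru_closed_span]): a regulator [w] of an
    ru-convergent sequence satisfies [0 <= 2 w], so all the order bounds in the
    definition of convergence live in [P - P], and hence so does the difference
    between the limit and a late term.  Therefore [W] is included in [P - P],
    so that [W - W = P - P]; as [A] lies in [W], generation of [X / A] by [[W]]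
    amounts to generation of [X] by [P].

    Second, for [u = p - q] with [p], [q] in [P], the sequence [u / (n + 1)]
    ru-converges to [0] with regulator [p + q] ([ru_cvg_span0]).  As the
    elements [u] of [W] have this form, [n y <= u] in [W] for all [n] says that
    [u / (n + 1) - y] is a sequence in [W] converging to [- y]; so [- y] is in
    [W], that is, [W] is Archimedean ([ru_closure_archimedean]).

    The rest is algebra: the lineality space of a wedge [W] is absorbed by [W],
    so that [[x]] is in [[W]] exactly when [x] is in [W]; hence [[W]] is a cone,
    Archimedean as soon as [W] is.  Finally, every wedge inside an Archimedean
    cone is an almost Archimedean cone, and [[P]] is such a wedge in [[W]]. *)

Set Implicit Arguments.
Unset Strict Implicit.
Unset Printing Implicit Defensive.

Import Order.TTheory GRing.Theory Num.Theory.
Local Open Scope classical_set_scope.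
Local Open Scope ring_scope.

(** * Wedges and cones *)

Section WedgeTheory.
Variables (R : realType) (X : lmodType R).
Implicit Types (P W B : set X) (x y u : X).

Lemma is_wedge0 W : is_wedge W -> W 0.
Proof. by case=> [[x Wx] _ WZ]; rewrite -(scale0r x); apply: WZ. Qed.

Lemma opp_setE B x : opp_set B x <-> B (- x).
Proof.
split=> [[y By <-]|BNx]; first by rewrite opprK.
by exists (- x); rewrite ?opprK.
Qed.

Lemma is_coneP W :
  is_cone W <-> is_wedge W /\ forall x, W x -> W (- x) -> x = 0.
Proof.
split=> [[wW W0]|[wW W0]]; split=> //.
  move=> x Wx WNx; suff : [set 0 : X] x by [].
  by rewrite -W0; split=> //; apply/opp_setE.
apply/seteqP; split=> [x [Wx /opp_setE WNx]|_ ->]; first exact: W0.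
by split; [|apply/opp_setE; rewrite oppr0]; apply: is_wedge0.
Qed.

Lemma sub_is_cone P W : P `<=` W -> is_wedge P -> is_cone W -> is_cone P.
Proof.
move=> PW wP /is_coneP[_ W0]; apply/is_coneP; split=> // x Px PNx.
by apply: W0; apply: PW.
Qed.

(** The two bounds [n y <= u] and [- n y <= u] give [y <= 0] and [- y <= 0] for
    the larger wedge, whence [y = 0] because that wedge is a cone. *)
Lemma sub_almost_archimedean P W :
  P `<=` W -> is_cone W -> archimedean W -> almost_archimedean P.
Proof.
move=> PW /is_coneP[_ W0] aW y [u Pu yu].
apply: W0.
- rewrite -[y]opprK -[- - y]add0r.
  apply: aW; exists u => [|n]; first exact: PW.
  by rewrite mulNrn; apply: PW; have [] := yu n.
- rewrite -[- y]add0r.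
  apply: aW; exists u => [|n]; first exact: PW.
  by apply: PW; have [] := yu n.
Qed.

End WedgeTheory.

(** * Quotient by the lineality space *)

Section WedgeImage.
Variables (R : realType) (X : lmodType R) (A : submodClosed X).

Lemma class_set_is_wedge B : is_wedge B -> is_wedge (class_set A B).
Proof.
case=> [[x Bx] BD BZ]; split; first by exists (class_of A x), x.
- move=> _ _ [y By <-] [z Bz <-].
  by exists (y + z); [apply: BD|rewrite linearD].
- move=> t _ t0 [y By <-].
  by exists (t *: y); [apply: BZ|rewrite linearZ].
Qed.

End WedgeImage.

Section LinealityQuotient.
Variables (R : realType) (X : lmodType R) (W : wedge X).
Local Notation A := (lineality W : submodClosed X).
Local Notation "[ x ]W" := (class_of A x) (at level 0, format "[ x ]W").
Local Notation qW := (class_set A W).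

Lemma linealityE x : x \in A <-> (W : set X) x /\ (W : set X) (- x).
Proof.
suff -> : (x \in A) = (x \in (W : set X) `&` opp_set W).
  by rewrite inE; split=> -[Wx /opp_setE].
by [].
Qed.

(** [W] is saturated for the quotient map: adding to [w] in [W] an element of
    the lineality space stays in [W]. *)
Lemma class_set_lineality x : qW [x]W <-> (W : set X) x.
Proof.
split=> [[w Ww /class_of_eq/linealityE[_ Wxw]]|Wx]; last by exists x.
have [_ WD _] := wedgeP W.
by rewrite -[x](subrK w) -opprB; apply: WD.
Qed.

Lemma class_set_lineality_cone : is_cone qW.
Proof.
apply/is_coneP; split; first exact/class_set_is_wedge/wedgeP.
move=> q; rewrite -[q]class_ofK -linearN => /class_set_lineality Wx.
move=> /class_set_lineality WNx.
by rewrite -(linear0 (class_of A)); apply/class_of_eq/linealityE; rewrite subr0.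
Qed.

Lemma class_set_lineality_archimedean :
  archimedean (W : set X) -> archimedean qW.
Proof.
move=> aW q [_ [u Wu <-]]; rewrite -[q]class_ofK => qu.
rewrite /wle sub0r -linearN; apply/class_set_lineality; rewrite -[- _]add0r.
apply: aW; exists u => // n.
by apply/class_set_lineality; rewrite linearB linearMn; apply: qu.
Qed.

Lemma class_set_lineality_generating : generating qW <-> generating W.
Proof.
split=> [gW|gW]; apply/seteqP; split=> //.
- move=> x _; have : [set: quot_space A] [x]W by [].
  rewrite -gW => -[_ [a Wa <-] [_ [b Wb <-]]] abx.
  exists a => //; exists (a - x); last by rewrite opprB addrC subrK.
  by apply/class_set_lineality; rewrite linearB/= -abx subKr; exists b.
- move=> q _; have : [set: X] (repr (q : Quotient.quot _)) by [].
  rewrite -gW => -[a Wa [b Wb]] abq.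
  exists [a]W; first exact/class_set_lineality.
  exists [b]W; first exact/class_set_lineality.
  by rewrite -linearB/= abq class_ofK.
Qed.

End LinealityQuotient.

(** * The span of the positive wedge and ru-convergence *)

Section RuSpan.
Variables (R : realType) (X : lmodType R) (P : set X) (wP : is_wedge P).
Local Notation span B := [set a - b | a in B & b in B].
Local Notation W := (ru_closure P P).

Let PD x y : P x -> P y -> P (x + y).
Proof. by case: wP => _ + _; apply. Qed.

Let PZ (t : R) x : 0 <= t -> P x -> P (t *: x).
Proof. by case: wP => _ _; apply. Qed.

Lemma ru_closed_span : ru_closed P (span P).
Proof.
move=> x_ x Px_ [w [m wm]].
have := wm 1%N (m 1%N) (leqnn _); rewrite /wle mulr1n opprK.
have [a Pa [b Pb abx]] := Px_ (m 1%N); rewrite -abx; set d := _ - x => -[wB wD].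
have Pw : P w.
  have -> : w = 2^-1 *: ((w - d) + (w + d)).
    rewrite addrACA addNr addr0 -mulr2n -scaler_nat scalerA mulVf ?scale1r //.
    by rewrite pnatr_eq0.
  by apply: PZ; [rewrite invr_ge0 ler0n|exact: PD].
(* Since [a - b] is the late term and [d] its difference with the limit,
   [x = (a - b) - d]; adding [w] to both parts makes them positive. *)
exists (a + (w - d)); first exact: PD.
exists (b + w); first exact: PD.
by rewrite [- (b + w)]opprD addrACA [w - d - w]addrAC subrr sub0r opprB addrC subrK.
Qed.

Lemma ru_closure_sub_span : W `<=` span P.
Proof.
apply: ru_closure_min ru_closed_span _ => x Px.
by exists x => //; exists 0; [exact: is_wedge0|rewrite subr0].
Qed.

Lemma ru_closure_generating : generating W <-> generating P.
Proof.
split=> gB; apply/seteqP; split=> // x _; have : [set: X] x by [].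
- rewrite -gB => -[_ /ru_closure_sub_span[a Pa [b Pb <-]]].
  move=> [_ /ru_closure_sub_span[c Pc [d Pd <-]] <-].
  exists (a + d); first exact: PD.
  by exists (b + c); [exact: PD|rewrite opprB addrACA -opprD].
- rewrite -gB => -[a Pa [b Pb <-]].
  exists a; first exact: sub_ru_closure.
  by exists b => //; apply: sub_ru_closure.
Qed.

(** For [u = p - q] and [0 <= t <= 1], both [(p + q) - t u] and [(p + q) + t u]
    are combinations of [p] and [q] with the nonnegative coefficients [1 - t]
    and [1 + t], so [p + q] is a regulator. *)
Lemma ru_cvg_span0 u : span P u -> ru_cvg P (fun n => n.+1%:R^-1 *: u) 0.
Proof.
move=> [p Pp [q Pq <-]]; exists (p + q), id => k n kn.
rewrite /wle subr0 scalerMnl; set t : R := _ *+ k.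
have t0 : 0 <= t by rewrite mulrn_wge0 ?invr_ge0 ?ler0n.
have t1 : t <= 1.
  by rewrite /t -[_ *+ k]mulr_natl ler_pdivrMr ?ltr0Sn // mul1r ler_nat ltnW.
have t1p : 0 <= 1 + t by rewrite addr_ge0.
have t1m : 0 <= 1 - t by rewrite subr_ge0.
split.
- have -> : p + q - t *: (p - q) = (1 - t) *: p + (1 + t) *: q.
    by rewrite scalerBl scalerDl !scale1r scalerBr opprB [_ - t *: p]addrC addrACA.
  by apply: PD; apply: PZ.
- have -> : p + q - - (t *: (p - q)) = (1 + t) *: p + (1 - t) *: q.
    by rewrite opprK scalerBl scalerDl !scale1r scalerBr addrACA.
  by apply: PD; apply: PZ.
Qed.

Lemma ru_closure_archimedean : archimedean W.
Proof.
move=> y [u Wu yu].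
have [_ _ WZ] := ru_closure_is_wedge wP.
have /ru_cvg_span0/(@ru_cvgD _ _ _ _ _ (- y)) := ru_closure_sub_span Wu.
apply: (@ru_closure_closed _ _ P) => n.
have -> : n.+1%:R^-1 *: u - y = n.+1%:R^-1 *: (u - y *+ n.+1).
  rewrite scalerBr -[y *+ _]scaler_nat scalerA mulVf ?scale1r //.
  by rewrite pnatr_eq0.
by apply: WZ; [rewrite invr_ge0 ler0n|exact: yu].
Qed.

End RuSpan.

Theorem theorem2p1 (R : realType) (X : lmodType R) (Xp : wedge X) :
  let W : wedge X := ru_closure_wedge Xp in
  let A : submodClosed X := lineality W in
  [/\ is_cone (class_set A W) /\ archimedean (class_set A W),
      is_cone (class_set A Xp) /\ almost_archimedean (class_set A Xp)
    & generating (class_set A W) <-> generating Xp].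
Proof.
move=> W A.
have cW : is_cone (class_set A W) by exact: class_set_lineality_cone.
have aW : archimedean (class_set A W).
  exact/class_set_lineality_archimedean/ru_closure_archimedean/wedgeP.
have XpW : class_set A Xp `<=` class_set A W.
  exact/image_subset/sub_ru_closure.
split; split=> //.
- exact/(sub_is_cone XpW)/cW/class_set_is_wedge/wedgeP.
- exact: sub_almost_archimedean XpW cW aW.
- move=> /class_set_lineality_generating.
  by move/(ru_closure_generating (wedgeP Xp)).
- move=> gXp; apply/class_set_lineality_generating.
  exact/(ru_closure_generating (wedgeP Xp)).
Qed.
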